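(* Let $p$ be a prime and $g$ an integer with $\gcd(g,p)=1$. Let $n$ be the least positive integer such that $g^n \equiv 1 \pmod p$, and suppose $n \not\equiv 2 \pmod 4$. Let $a \ge 0$ be an integer and let $h$ be an integer with $h \equiv g^a \pmod p$. Then $Q(g,h^2,p)$ is invertible modulo $p$ and \[ g^{a^2} \equiv Q(g,1,p)\,\bigl(Q(g,h^2,p)\bigr)^{-1} \pmod p. \]
   Context: For a prime $p$ and integers $g,h$, the quadratic sum is defined as $Q(g,h,p) = \sum_{k=1}^{p-1} g^{k^2} h^k \pmod p$. *)

(* Defs.v *)
From mathcomp Require Import all_boot all_order all_algebra.
Set Implicit Arguments.
Unset Strict Implicit.
Unset Printing Implicit Defensive.
Import GRing.Theory.
Local Open Scope ring_scope.

(* The sum is taken in 'F_p, which is Z/pZ when p is prime. *)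
Definition quadratic_sum (g h : int) (p : nat) : 'F_p :=
  \sum_(1 <= k < p) (g%:~R ^+ (k ^ 2)%N * h%:~R ^+ k).

(* Main.v *)
Require Import Defs.
From mathcomp Require Import all_boot all_order all_algebra.
From mathcomp Require Import finfield zify.
Local Open Scope ring_scope.

(** Write [z] for the class of [g] and [N = p - 1].  As [k |-> z ^ (k ^ 2)] has
    period [N], completing the square gives [z ^ (a ^ 2) * Q(g, h^2) = Q(g, 1)],
    so the point is that [S = \sum_(k < N) z ^ (k ^ 2)] is nonzero.  Multiplying
    by the sum for [z^-1] and summing over differences, [S * S'] equals
    [N * \sum_d z ^ (d ^ 2)] over the [d < N] with [n %| 2 d].  When
    [n %% 4 != 2] each of these terms is [1], so [S * S' = N * c] where [c] counts
    such [d]; since [0 < c <= N < p], this is nonzero modulo [p]. *)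

Set Implicit Arguments.
Unset Strict Implicit.
Unset Printing Implicit Defensive.
Import GRing.Theory.

Lemma sum_periodic_shift (V : zmodType) (f : nat -> V) (N a : nat) :
  (forall k, f (k + N)%N = f k) ->
  \sum_(0 <= k < N) f (k + a)%N = \sum_(0 <= k < N) f k.
Proof.
move=> fN; elim: a => [|a <-]; first by under eq_bigr do rewrite addn0.
under eq_bigr do rewrite addnS -addSn.
(* With [f (0 + a)] added, the left side becomes a sum of [N + 1] consecutive values; its last term
   [f (N + a)] equals [f a] by periodicity. *)
apply: (addrI (f (0 + a)%N)).
rewrite -(big_nat_recl N 0 (fun k => f (k + a)%N)) // big_nat_recr //=.
by rewrite (addnC N) fN add0n addrC.
Qed.

Lemma expr_sqr_periodic (R : pzSemiRingType) (z : R) (N k : nat) :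
  z ^+ N = 1 -> z ^+ ((k + N) ^ 2) = z ^+ (k ^ 2).
Proof.
move=> zN; rewrite sqrnD -addnA exprD.
have -> : (N ^ 2 + 2 * (k * N) = N * (N + 2 * k))%N.
  by rewrite mulnDr -mulnn (mulnC k) mulnCA.
by rewrite exprM zN expr1n mulr1.
Qed.

Lemma sum_expr_unity_root (F : fieldType) (w : F) (N : nat) :
  w ^+ N = 1 -> \sum_(0 <= k < N) w ^+ k = (w == 1)%:R * N%:R.
Proof.
move=> wN; have [->|w1] := eqVneq w 1.
  under eq_bigr do rewrite expr1n.
  by rewrite sumr_const_nat subn0 mul1r.
rewrite mul0r; apply/eqP; have /eqP := subrX1 w N.
by rewrite wN subrr eq_sym mulf_eq0 subr_eq0 (negPf w1) /= big_mkord.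
Qed.

(** If [n] is odd, it already divides [d]. Otherwise [n = 4 m], so [2 m] divides [d] and [4 m ^ 2]
    divides [d ^ 2]. The case [n = 2], [d = 1] shows why residue 2 is excluded. *)
Lemma dvdn_double_sqr (n d : nat) :
  (n %% 4 <> 2 -> n %| 2 * d -> n %| d ^ 2)%N.
Proof.
move=> n4 nd; have [n_odd|n_even] := boolP (odd n).
  by apply: dvdn_mulr; rewrite -(@Gauss_dvdr n 2) // coprime_sym coprime2n.
have /dvdnP[m En] : (4 %| n)%N.
  rewrite /dvdn; move: n4 n_even (ltn_pmod n (isT : 0 < 4)%N).
  rewrite {2}(divn_eq n 4) oddD oddM andbF /=.
  by case: (n %% 4)%N => [|[|[|[|]]]].
have /dvdnP[e Ed] : (2 * m %| d)%N.
  by rewrite -(@dvdn_pmul2l 2) // mulnA mulnC -En.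
by apply/dvdnP; exists (e ^ 2 * m)%N; rewrite Ed En; nia.
Qed.

(** The hypothesis on [c] keeps both [N] and the count of the [d] with [n %| 2 * d] nonzero in
    [F]. *)
Lemma quadratic_gauss_sum_neq0 (F : fieldType) (n N : nat) (z : F) :
  n.-primitive_root z -> z ^+ N = 1 -> (n %% 4 <> 2)%N -> (0 < N)%N ->
  (forall c, (0 < c <= N)%N -> c%:R != 0 :> F) ->
  \sum_(0 <= k < N) z ^+ (k ^ 2) != 0.
Proof.
move=> zn zN n4 N_gt0 charF.
have z_neq0 : z != 0.
  by apply: contra_eq_neq zN => ->; rewrite expr0n gtn_eqF // eq_sym oner_eq0.
set S := \sum_(_ <= k < _) _.
set S' := \sum_(0 <= k < N) z ^- (k ^ 2).
suff: S * S' != 0 by apply: contra_neq => ->; rewrite mul0r.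
have -> : S * S' =
    \sum_(0 <= d < N) z ^+ (d ^ 2) * \sum_(0 <= k < N) (z ^+ (2 * d)) ^+ k.
  under [RHS]eq_bigr do rewrite mulr_sumr.
  rewrite exchange_big /= /S' mulr_sumr; apply: eq_bigr => k _.
  (* For fixed [k], shifting the index of [S] by [k] leaves the exponent
     [(d + k) ^ 2 - k ^ 2 = d ^ 2 + 2 d k]. *)
  rewrite /S -(@sum_periodic_shift _ (fun j => z ^+ (j ^ 2)) N k); last first.
    by move=> j; apply: expr_sqr_periodic.
  rewrite mulr_suml; apply: eq_bigr => d _.
  rewrite sqrnD addnAC exprD mulfK ?expf_neq0 //.
  by rewrite exprD mulnA exprM.
have -> : \sum_(0 <= d < N) z ^+ (d ^ 2) * \sum_(0 <= k < N) (z ^+ (2 * d)) ^+ k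
    = (\sum_(0 <= d < N) (n %| 2 * d)%N)%N%:R * N%:R.
  rewrite natr_sum mulr_suml; apply: eq_bigr => d _.
  rewrite sum_expr_unity_root; last by rewrite exprAC zN expr1n.
  rewrite -(prim_order_dvd zn).
  have [nd|_] := boolP (n %| 2 * d)%N; last by rewrite !mul0r mulr0.
  have /eqP -> : z ^+ (d ^ 2) == 1.
    by rewrite -(prim_order_dvd zn) dvdn_double_sqr.
  by rewrite mul1r.
rewrite mulf_neq0 ?charF ?N_gt0 ?leqnn //; apply/andP; split.
  (* The index [d = 0] is always counted. *)
  by rewrite big_ltn // muln0 dvdn0.
apply: (@leq_trans (\sum_(0 <= d < N) 1)%N).
  by apply: leq_sum => d _; apply: leq_b1.
by rewrite sum_nat_const_nat subn0 muln1.
Qed.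

Lemma intr_Fp_eq (p : nat) (x y : int) : prime p ->
  ((x%:~R : 'F_p) == y%:~R) = (x == y %[mod p])%Z.
Proof.
move=> p_pr; rewrite -subr_eq0 -rmorphB /= eqz_mod_dvd.
by rewrite -(dvdz_pcharf (pchar_Fp p_pr)).
Qed.

Theorem theorem1 (p : nat) (g : int) (n a : nat) (h : int) :
  prime p ->
  coprimez g p ->
  (0 < n)%N ->
  (g ^+ n = 1 %[mod p])%Z ->
  (forall m : nat, (0 < m)%N -> (g ^+ m = 1 %[mod p])%Z -> (n <= m)%N) ->
  (n <> 2 %[mod 4])%N ->
  (h = g ^+ a %[mod p])%Z ->
  quadratic_sum g (h ^+ 2) p \is a GRing.unit /\
  g%:~R ^+ (a ^ 2)%N = quadratic_sum g 1 p * (quadratic_sum g (h ^+ 2) p)^-1.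
Proof.
move=> p_pr _ n_gt0 gn n_min n4 hga.
set z : 'F_p := g%:~R.
have z_pow m : (z ^+ m == 1) = (g ^+ m == 1 %[mod p])%Z.
  by rewrite -intr_Fp_eq // rmorphXn /= rmorph1.
have zn : z ^+ n = 1 by apply/eqP; rewrite z_pow; apply/eqP.
have z_prim : n.-primitive_root z.
  (* The exact order [m] of [z] divides [n], and minimality of [n] gives [n <= m]. *)
  have [m zm m_dvd] := prim_order_exists n_gt0 zn.
  suff -> : n = m by [].
  apply/eqP; rewrite eqn_leq (dvdn_leq n_gt0 m_dvd) andbT.
  apply: n_min; first exact: prim_order_gt0 zm.
  by apply/eqP; rewrite -z_pow prim_expr_order.
have z_neq0 : z != 0.
  by apply: contra_eq_neq zn => ->; rewrite expr0n gtn_eqF // eq_sym oner_eq0.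
have p1_gt0 : (0 < p.-1)%N by rewrite -subn1 subn_gt0 prime_gt1.
have zp : z ^+ p.-1 = 1.
  apply: (mulfI z_neq0); rewrite -exprS prednK ?prime_gt0 // mulr1.
  by rewrite -{2}(expf_card z) card_Fp.
have hz : (h%:~R : 'F_p) = z ^+ a.
  by apply/eqP; rewrite -rmorphXn /= intr_Fp_eq //; apply/eqP.
have perz k : z ^+ ((k + p.-1) ^ 2) = z ^+ (k ^ 2) by apply: expr_sqr_periodic.
pose S := \sum_(0 <= k < p.-1) z ^+ (k ^ 2).
have shiftS b : \sum_(1 <= k < p) z ^+ ((k + b) ^ 2) = S.
  (* Starting at 1 instead of 0 amounts to a shift by [b + 1] over one full period. *)
  rewrite big_add1 /=.
  under eq_bigr do rewrite addSnnS.
  exact: (@sum_periodic_shift _ (fun k => z ^+ (k ^ 2))).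
have Q1 : quadratic_sum g 1 p = S.
  rewrite -(shiftS 0); apply: eq_bigr => k _.
  by rewrite rmorph1 expr1n mulr1 addn0.
have Qh : z ^+ (a ^ 2) * quadratic_sum g (h ^+ 2) p = S.
  rewrite -(shiftS a) mulr_sumr; apply: eq_bigr => k _.
  (* Since [h ^ 2] contributes [z ^ (2 a k)], the exponents add up to [(k + a) ^ 2]. *)
  rewrite rmorphXn /= hz -!exprM mulrA -!exprD; congr (_ ^+ _).
  lia.
have S_neq0 : S != 0.
  apply: (@quadratic_gauss_sum_neq0 _ n) => // c /andP[c_gt0 c_le].
  rewrite -(dvdn_pcharf (pchar_Fp p_pr)) gtnNdvd //.
  by apply: leq_ltn_trans c_le _; rewrite prednK ?prime_gt0.
have Q_neq0 : quadratic_sum g (h ^+ 2) p != 0.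
  by apply: contra_neq S_neq0 => Q0; rewrite -Qh Q0 mulr0.
by split; [rewrite unitfE | rewrite Q1 -Qh mulfK].
Qed.
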